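(* Let $0<a<b$ and $K_1>K_2>0$, let $I_1,\dots,I_N$ be a partition of $[0,a]$ and $I'_1,\dots,I'_N$ a partition of $[a,b]$. Let $\beta_c$, $\beta'_c$ and $\beta''_c$ be the critical numbers of, respectively, the continuous system, the Min-Mixed system and the Max-Mixed system. Then $$\beta'_c\ge\beta_c\ge\beta''_c .$$ Besides, if $(u,v)_m$ and $(u,v)_M$ are solutions of the Min-Mixed system and the Max-Mixed system, respectively, and $(u,v)$ is the solution of the continuous system, then $$(u,v)_m\le (u,v)\le (u,v)_M .$$
   Context: All three systems carry the same parameter $\beta>0$ (inverse temperature). For $0<\beta<\infty$, $f_\beta(t)=\dfrac{\tanh(\beta t/2)}{t}$ for $t>0$ and $f_\beta(0)=\beta/2$; for $\beta=\infty$, $f_\infty(t)=1/t$ for $t>0$. A partition of a compact interval $J$ is a finite family of pairwise disjoint nonempty open subintervals of $J$ whose closures cover $J$; $|\overline{I}|$ denotes the length of $\overline{I}$. The continuous system, for real $(u,v)$, is $$u=(K_1-K_2)A_\beta(u)+K_2B_\beta(v),\qquad v=K_2A_\beta(u)-K_2B_\beta(v),$$ where $A_\beta(u)=u\int_0^a f_\beta(\sqrt{u^2+x^2})\,dx$ and $B_\beta(v)=v\int_a^b f_\beta(\sqrt{v^2+x^2})\,dx$. The Min-Mixed system is $$u=(K_1-K_2)\,u\sum_{k=1}^{N}\min_{x\in\overline{I}_k}f_\beta(\sqrt{u^2+x^2})|\overline{I}_k|+K_2\,v\sum_{k=1}^{N}\min_{x\in\overline{I'}_k}f_\beta(\sqrt{v^2+x^2})|\overline{I'}_k|,$$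 $$v+K_2\,v\sum_{k=1}^{N}\max_{x\in\overline{I'}_k}f_\beta(\sqrt{v^2+x^2})|\overline{I'}_k|=K_2\,u\sum_{k=1}^{N}\min_{x\in\overline{I}_k}f_\beta(\sqrt{u^2+x^2})|\overline{I}_k|.$$ The Max-Mixed system is $$u=(K_1-K_2)\,u\sum_{k=1}^{N}\max_{x\in\overline{I}_k}f_\beta(\sqrt{u^2+x^2})|\overline{I}_k|+K_2\,v\sum_{k=1}^{N}\max_{x\in\overline{I'}_k}f_\beta(\sqrt{v^2+x^2})|\overline{I'}_k|,$$ $$v+K_2\,v\sum_{k=1}^{N}\min_{x\in\overline{I'}_k}f_\beta(\sqrt{v^2+x^2})|\overline{I'}_k|=K_2\,u\sum_{k=1}^{N}\max_{x\in\overline{I}_k}f_\beta(\sqrt{u^2+x^2})|\overline{I}_k|.$$ The critical number of one of these systems is the number $\beta_*>0$ such that for every $\beta>\beta_*$ the system has a nontrivial solution with $u>0$, $v>0$, while for $\beta<\beta_*$ its only solution is $u=0$, $v=0$. For pairs, $(u,v)\le(u',v')$ means $u\le u'$ and $v\le v'$. *)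

(* Defs.v *)
From mathcomp Require Import all_boot all_order all_algebra.
From mathcomp Require Import all_classical all_reals all_analysis.

Set Implicit Arguments.
Unset Strict Implicit.
Unset Printing Implicit Defensive.

Import Order.TTheory GRing.Theory Num.Theory.
Import numFieldNormedType.Exports.

Local Open Scope classical_set_scope.
Local Open Scope ring_scope.

Definition tanh (R : realType) (x : R) : R :=
  (expR x - expR (- x)) / (expR x + expR (- x)).

(* The inverse temperature [beta] is extended real, so that [beta = +oo] is
   allowed; only [0 < beta] and [0 <= t] are meaningful.  At [beta = +oo] the
   value at [t = 0], which the mathematics leaves undefined, is [0^-1 = 0]; in
   the systems below it is reached only for [u = 0], and is then multiplied by
   [u]. *)
Definition fbeta (R : realType) (beta : \bar R) (t : R) : R :=
  match beta with
  | EFin b => if t == 0 then b / 2 else tanh (b * t / 2) / t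
  | _ => t^-1
  end.

Definition is_partition (R : realType) (J : set R) (N : nat)
    (I : 'I_N -> set R) : Prop :=
  [/\ forall k, exists x y : R, x < y /\ I k = `]x, y[%classic,
      forall k, I k `<=` J,
      trivIset setT I
    & J `<=` \bigcup_k closure (I k)].

(* The least and greatest elements of a set of reals (they are unique when
   they exist; the default value 0 is used when they do not). *)
Definition set_min (R : realType) (A : set R) : R :=
  xget 0 (A `&` lbound A).

Definition set_max (R : realType) (A : set R) : R :=
  xget 0 (A `&` ubound A).

Definition set_length (R : realType) (A : set R) : R :=
  fine (lebesgue_measure A).

Definition min_sum (R : realType) (N : nat) (I : 'I_N -> set R)
    (beta : \bar R) (w : R) : R :=
  \sum_(k < N)
    set_min [set fbeta beta (Num.sqrt (w ^+ 2 + x ^+ 2)) | x in closure (I k)]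
    * set_length (closure (I k)).

Definition max_sum (R : realType) (N : nat) (I : 'I_N -> set R)
    (beta : \bar R) (w : R) : R :=
  \sum_(k < N)
    set_max [set fbeta beta (Num.sqrt (w ^+ 2 + x ^+ 2)) | x in closure (I k)]
    * set_length (closure (I k)).

Definition A_beta (R : realType) (a : R) (beta : \bar R) (u : R) : R :=
  u * \int[lebesgue_measure]_(x in `[0, a])
        fbeta beta (Num.sqrt (u ^+ 2 + x ^+ 2)).

Definition B_beta (R : realType) (a b : R) (beta : \bar R) (v : R) : R :=
  v * \int[lebesgue_measure]_(x in `[a, b])
        fbeta beta (Num.sqrt (v ^+ 2 + x ^+ 2)).

Definition continuous_system (R : realType) (a b K1 K2 : R)
    (beta : \bar R) (u v : R) : Prop :=
  u = (K1 - K2) * A_beta a beta u + K2 * B_beta a b beta v /\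
  v = K2 * A_beta a beta u - K2 * B_beta a b beta v.

Definition min_mixed_system (R : realType) (K1 K2 : R) (N : nat)
    (I I' : 'I_N -> set R) (beta : \bar R) (u v : R) : Prop :=
  u = (K1 - K2) * u * min_sum I beta u + K2 * v * min_sum I' beta v /\
  v + K2 * v * max_sum I' beta v = K2 * u * min_sum I beta u.

Definition max_mixed_system (R : realType) (K1 K2 : R) (N : nat)
    (I I' : 'I_N -> set R) (beta : \bar R) (u v : R) : Prop :=
  u = (K1 - K2) * u * max_sum I beta u + K2 * v * max_sum I' beta v /\
  v + K2 * v * min_sum I' beta v = K2 * u * max_sum I beta u.

(* Below, [S beta u v] says that [(u, v)] satisfies a given system at inverse
   temperature [beta]. *)

Definition only_trivial (R : realType) (S : \bar R -> R -> R -> Prop)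
    (beta : \bar R) : Prop :=
  forall u v : R, S beta u v <-> u = 0 /\ v = 0.

Definition critical_number (R : realType) (S : \bar R -> R -> R -> Prop)
    (bc : R) : Prop :=
  [/\ 0 < bc,
      forall beta : \bar R, (bc%:E < beta)%E ->
        exists u v : R, [/\ 0 < u, 0 < v & S beta u v]
    & forall beta : \bar R, (0 < beta)%E -> (beta < bc%:E)%E ->
        only_trivial S beta].

(* The trivial pair satisfies each system at every [beta], and the systems are
   odd in [(u, v)]; "solution" therefore designates a nontrivial solution with
   [u > 0] and [v > 0], or [(0, 0)] when that is the only solution. *)
Definition solution (R : realType) (S : \bar R -> R -> R -> Prop)
    (beta : \bar R) (u v : R) : Prop :=
  S beta u v /\
  ((0 < u /\ 0 < v) \/ (u = 0 /\ v = 0 /\ only_trivial S beta)).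

Definition pair_le (R : realType) (p q : R * R) : Prop :=
  p.1 <= q.1 /\ p.2 <= q.2.

(* Main.v *)
(* Each system reads [u = (K1 - K2) u al(u) + K2 v ga(v)] and
   [v (1 + K2 de(v)) = K2 u al(u)], where [ga = de = g] in the continuous case,
   while the mixed systems perturb [al], [ga] and [de] in the directions that
   weaken (Min) or strengthen (Max) the right-hand sides.  Eliminating [v] gives
   [1 = al(u) (K1 - K2 + K2^2 ga(v) / (1 + K2 de(v)))], which decreases in [u]
   and [v]; the opposite monotonicity of [u al(u)] and [v g(v)] settles the case
   where [u] and [v] are ordered differently, so positive solutions of a weaker
   system lie below those of a stronger one.  A positive solution of the weaker
   system is a subsolution of the stronger one, and a Knaster-Tarski argument
   turns it into a solution; this compares the critical numbers and excludes a
   trivial solution above a positive one. *)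
Require Import Defs.
From mathcomp Require Import all_boot all_order all_algebra.
From mathcomp Require Import all_classical all_reals all_analysis.
From mathcomp Require Import measurable_realfun ring lra.

Set Implicit Arguments.
Unset Strict Implicit.
Unset Printing Implicit Defensive.

Import Order.TTheory GRing.Theory Num.Theory.
Import numFieldNormedType.Exports.

Local Open Scope classical_set_scope.
Local Open Scope ring_scope.

(** * The common shape of the three systems *)

(* All three systems have this shape, with [al], [ga], [de] the sums or
   integrals multiplying [u], the first [v] and the second [v]. *)
Definition mixed_system (R : realType) (K1 K2 : R) (al ga de : R -> R)
    (u v : R) : Prop :=
  u = (K1 - K2) * u * al u + K2 * v * ga v /\
  v + K2 * v * de v = K2 * u * al u.

(** The features of f_beta(sqrt(w^2 + x^2)), as a function of w, that survive weighted sums and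
    integrals over x. Only positive arguments count, since at [beta = +oo] the value at 0 is a mere
    convention. The bound on [t * g t] makes the suprema in the fixed point argument finite. *)
Record regular (R : realType) (g : R -> R) : Prop := Regular {
  regular_ge0 : forall t : R, 0 < t -> 0 <= g t;
  regular_antitone : forall s t : R, 0 < s -> s <= t -> g t <= g s;
  regular_mul_mono : forall s t : R, 0 < s -> s <= t -> s * g s <= t * g t;
  regular_mul_bound : exists M, forall t : R, 0 < t -> t * g t <= M }.

Definition le_on_pos (R : realType) (f g : R -> R) : Prop :=
  forall t : R, 0 < t -> f t <= g t.

(** Both quotients are compared with h1 / (1 + K h1) by cross-multiplication. In use, [h1] and [h2]
    are values of the exact integral, which separates the two perturbed systems. *)
Lemma div_one_plus_mono (R : realType) (K g1 d1 g2 d2 h1 h2 : R) :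
  0 <= K -> 0 <= d2 -> 0 <= h1 -> h1 <= h2 ->
  g1 <= h1 -> h1 <= d1 -> d2 <= h2 -> h2 <= g2 ->
  g1 / (1 + K * d1) <= g2 / (1 + K * d2).
Proof.
move=> K0 d20 h10 h12 gh1 hd1 dh2 hg2.
have p1 : 0 < 1 + K * h1 by rewrite ltr_pwDl// mulr_ge0.
have p2 : 0 < 1 + K * d1 by rewrite ltr_pwDl// mulr_ge0//; lra.
have p3 : 0 < 1 + K * d2 by rewrite ltr_pwDl// mulr_ge0.
apply: (@le_trans _ _ (h1 / (1 + K * h1))).
  rewrite ler_pdivrMr// mulrAC ler_pdivlMr//.
  have : K * h1 * g1 <= K * h1 * d1.
    by apply: ler_wpM2l; [exact: mulr_ge0|lra].
  lra.
rewrite ler_pdivrMr// mulrAC ler_pdivlMr//.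
have : K * h1 * d2 <= K * h1 * g2.
  by apply: ler_wpM2l; [exact: mulr_ge0|lra].
lra.
Qed.

(** * Comparison of positive solutions *)

Section comparison.
Context (R : realType) (K1 K2 : R) (hK2 : 0 < K2) (hK : K2 < K1).
(* [al] is meant to be a finite sum, [al1] or [al2] itself, whose strict
   monotonicity is immediate, unlike that of the integrals. *)
Context (al1 ga1 de1 al2 ga2 de2 al g : R -> R).
Hypotheses (al_reg : regular al) (g_reg : regular g).
Hypothesis al_strict : forall s t : R, 0 < s -> s < t -> al t < al s.
Hypotheses (le_al1 : le_on_pos al1 al) (le_al2 : le_on_pos al al2).
Hypotheses (le_ga1 : le_on_pos ga1 g) (le_de1 : le_on_pos g de1).
Hypotheses (le_de2 : le_on_pos de2 g) (le_ga2 : le_on_pos g ga2).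
Hypothesis al1_ge0 : forall t : R, 0 < t -> 0 <= al1 t.
Hypothesis de2_ge0 : forall t : R, 0 < t -> 0 <= de2 t.

Lemma mixed_system_alE (ga de ap : R -> R) (u v : R) : 0 < u -> 0 < v ->
  0 <= de v -> mixed_system K1 K2 ap ga de u v ->
  1 = ap u * ((K1 - K2) + K2 ^+ 2 * (ga v / (1 + K2 * de v))).
Proof.
move=> u0 v0 d0 [e1 e2].
have p : 1 + K2 * de v != 0 by rewrite lt0r_neq0// ltr_pwDl// mulr_ge0// ltW.
have ev : v = K2 * u * ap u / (1 + K2 * de v).
  by rewrite -e2; field.
apply: (mulfI (lt0r_neq0 u0)); rewrite mulr1 {1}e1 {1}ev; field.
exact: p.
Qed.

Lemma mixed_system_le (u1 v1 u2 v2 : R) :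
  0 < u1 -> 0 < v1 -> 0 < u2 -> 0 < v2 ->
  mixed_system K1 K2 al1 ga1 de1 u1 v1 ->
  mixed_system K1 K2 al2 ga2 de2 u2 v2 -> u1 <= u2 /\ v1 <= v2.
Proof.
move=> u10 v10 u20 v20 S1 S2.
have [A0 _ Am _] := al_reg; have [g0 ga gm _] := g_reg.
have d20 := de2_ge0 v20.
have d10 : 0 <= de1 v1 by apply: le_trans (le_de1 v10); apply: g0.
have u12 : u1 <= u2.
  rewrite leNgt; apply/negP => lt_u.
  have al_lt : al1 u1 < al2 u2.
    apply: le_lt_trans (le_al1 u10) _.
    by apply: lt_le_trans (al_strict u20 lt_u) (le_al2 u20).
  have [le_v|lt_v] := leP v2 v1.
    (* With u2 < u1 and v2 <= v1, the right-hand side of the reduced equation is strictly larger for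
       the second system, yet both equal 1. *)
    have e1 := mixed_system_alE u10 v10 d10 S1.
    have e2 := mixed_system_alE u20 v20 d20 S2.
    have := @div_one_plus_mono R K2 (ga1 v1) (de1 v1) (ga2 v2) (de2 v2)
      (g v1) (g v2) (ltW hK2) d20 (g0 _ v10) (ga _ _ v20 le_v)
      (le_ga1 v10) (le_de1 v10) (le_de2 v20) (le_ga2 v20).
    move: e1 e2; set q1 := ga1 v1 / _; set q2 := ga2 v2 / _ => e1 e2 q12.
    have a2 : 0 <= al2 u2 by apply: le_trans (le_al2 u20); apply: A0.
    have q2_ge0 : 0 <= q2.
      apply: divr_ge0; last by rewrite addr_ge0// mulr_ge0// ltW.
      by apply: le_trans (le_ga2 v20); apply: g0.
    set c1 := K1 - K2 + K2 ^+ 2 * q1 in e1.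
    set c2 := K1 - K2 + K2 ^+ 2 * q2 in e2.
    have c12 : c1 <= c2 by rewrite lerD2l ler_pM2l// exprn_gt0.
    have c2_gt0 : 0 < c2
      by rewrite /c2 ltr_pwDl// ?subr_gt0// mulr_ge0// exprn_ge0// ltW.
    have : al1 u1 * c2 < al2 u2 * c2 by rewrite ltr_pM2r.
    have := ler_wpM2l (al1_ge0 u10) c12; lra.
  (* With u2 < u1 and v1 < v2, the first equation, as u (1 - (K1 - K2) al(u)) = K2 v ga(v), is
     contradictory: its left side is strictly larger for the first system, its right side is not,
     because v g(v) is nondecreasing. *)
  have [e1 _] := S1; have [e2 _] := S2.
  have vg : v1 * ga1 v1 <= v2 * ga2 v2.
    have h1 : v1 * ga1 v1 <= v1 * g v1 by rewrite ler_pM2l// le_ga1.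
    have h2 : v2 * g v2 <= v2 * ga2 v2 by rewrite ler_pM2l// le_ga2.
    exact: le_trans h1 (le_trans (gm _ _ v10 (ltW lt_v)) h2).
  have vg0 : 0 <= v2 * ga2 v2.
    by apply: mulr_ge0 (ltW v20) (le_trans (g0 _ v20) (le_ga2 v20)).
  have m1 : u1 * (1 - (K1 - K2) * al1 u1) = K2 * (v1 * ga1 v1).
    by lra.
  have m2 : u2 * (1 - (K1 - K2) * al2 u2) = K2 * (v2 * ga2 v2).
    by lra.
  have dk : (K1 - K2) * al1 u1 < (K1 - K2) * al2 u2.
    by rewrite ltr_pM2l// subr_gt0.
  have x2 : 0 <= 1 - (K1 - K2) * al2 u2.
    by rewrite -(pmulr_rge0 _ u20) m2 mulr_ge0// ltW.
  have : u2 * (1 - (K1 - K2) * al2 u2) < u1 * (1 - (K1 - K2) * al1 u1).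
    by apply: ltr_pM => //; lra.
  by rewrite m1 m2 ltr_pM2l// ltNge vg.
(* Once u1 <= u2, the second equation orders v1 and v2: v2 < v1 would make its left side strictly
   larger for the first system, while u al(u) is no larger there. *)
split=> //; rewrite leNgt; apply/negP => lt_v.
have [_ e1] := S1; have [_ e2] := S2.
have ua : u1 * al1 u1 <= u2 * al2 u2.
  have h1 : u1 * al1 u1 <= u1 * al u1 by rewrite ler_pM2l// le_al1.
  have h2 : u2 * al u2 <= u2 * al2 u2 by rewrite ler_pM2l// le_al2.
  exact: le_trans h1 (le_trans (Am _ _ u10 u12) h2).
have vd : v2 * de2 v2 <= v1 * de1 v1.
  have h1 : v1 * g v1 <= v1 * de1 v1 by rewrite ler_pM2l// le_de1.
  have h2 : v2 * de2 v2 <= v2 * g v2 by rewrite ler_pM2l// le_de2.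
  exact: le_trans h2 (le_trans (gm _ _ v20 (ltW lt_v)) h1).
have := ler_wpM2l (ltW hK2) ua; have := ler_wpM2l (ltW hK2) vd; lra.
Qed.

End comparison.

(** * Existence of a positive solution of the stronger system *)

Section existence.
Context (R : realType) (K1 K2 : R) (hK2 : 0 < K2) (hK : K2 < K1).
Context (al1 ga1 de1 al2 ga2 de2 : R -> R).
Hypotheses (al2_reg : regular al2) (ga2_reg : regular ga2).
Hypothesis de2_reg : regular de2.
Hypotheses (le_al : le_on_pos al1 al2) (le_ga : le_on_pos ga1 ga2).
Hypothesis le_de : le_on_pos de2 de1.

(* The greatest fixed point of the monotone map [T] above [(u1, v1)], which is
   a subsolution of the second system, as in the Knaster-Tarski theorem. *)
Lemma mixed_system_exists (u1 v1 : R) : 0 < u1 -> 0 < v1 ->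
  mixed_system K1 K2 al1 ga1 de1 u1 v1 ->
  exists u v, [/\ 0 < u, 0 < v & mixed_system K1 K2 al2 ga2 de2 u v].
Proof.
move=> u10 v10 [e1 e2].
have [A0 Aa Am [MA hMA]] := al2_reg; have [g0 ga gm [MG hMG]] := ga2_reg.
have [d0 da _ _] := de2_reg.
have hk : 0 < K1 - K2 by rewrite subr_gt0.
(* The second equation is solved for v by division: moving v de2(v) to the right instead would give
   a term nonincreasing in v and spoil the monotonicity of the map. *)
pose T1 u v := (K1 - K2) * (u * al2 u) + K2 * (v * ga2 v).
pose T2 u v := K2 * (u * al2 u) / (1 + K2 * de2 v).
have pos v : 0 < v -> 0 < 1 + K2 * de2 v.
  by move=> /d0 ?; rewrite ltr_pwDl// mulr_ge0// ltW.
have T1m u v u' v' : 0 < u -> 0 < v -> u <= u' -> v <= v' ->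
    T1 u v <= T1 u' v'.
  by move=> ? ? ? ?; apply: lerD; rewrite ler_pM2l//; auto.
have T2m u v u' v' : 0 < u -> 0 < v -> u <= u' -> v <= v' ->
    T2 u v <= T2 u' v'.
  move=> u0 v0 uu vv; apply: ler_pM.
  - exact: mulr_ge0 (ltW hK2) (mulr_ge0 (ltW u0) (A0 _ u0)).
  - by rewrite invr_ge0 ltW// pos.
  - by rewrite ler_pM2l// Am.
  - rewrite lef_pV2 ?posrE ?pos//; last exact: lt_le_trans vv.
    by rewrite lerD2l ler_pM2l// da.
have T2b u v : 0 < u -> 0 < v -> T2 u v <= K2 * MA.
  move=> u0 v0; rewrite /T2 ler_pdivrMr ?pos//.
  have h1 := hMA _ u0; have h2 := d0 _ v0; have h3 := A0 _ u0.
  have h4 : 0 <= u * al2 u by rewrite mulr_ge0// ltW.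
  have : K2 * (u * al2 u) <= K2 * MA by rewrite ler_pM2l.
  have : 0 <= (K2 * MA) * (K2 * de2 v).
    exact: mulr_ge0 (mulr_ge0 (ltW hK2) (le_trans h4 h1))
      (mulr_ge0 (ltW hK2) h2).
  lra.
pose P u v := [/\ u1 <= u, v1 <= v, u <= T1 u v & v <= T2 u v].
have P1 : P u1 v1.
  split=> //.
    have h1 : u1 * al1 u1 <= u1 * al2 u1 by rewrite ler_pM2l// le_al.
    have h2 : v1 * ga1 v1 <= v1 * ga2 v1 by rewrite ler_pM2l// le_ga.
    have := ler_wpM2l (ltW hk) h1; have := ler_wpM2l (ltW hK2) h2.
    rewrite /T1; lra.
  rewrite /T2 ler_pdivlMr ?pos//.
  have h1 : u1 * al1 u1 <= u1 * al2 u1 by rewrite ler_pM2l// le_al.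
  have h2 : v1 * de2 v1 <= v1 * de1 v1 by rewrite ler_pM2l// le_de.
  have := ler_wpM2l (ltW hK2) h1; have := ler_wpM2l (ltW hK2) h2; lra.
(* The suprema are taken separately in each coordinate, so it is not immediate that the pair (u, v)
   lies in [P]; monotonicity of [T1] and [T2] will show that it is still a subsolution. *)
pose U := [set u | exists v, P u v]; pose V := [set v | exists u, P u v].
have supU : has_sup U.
  split; first by exists u1, v1.
  exists ((K1 - K2) * MA + K2 * MG) => u [v [uu vv h _]].
  by apply: le_trans h _; apply: lerD; rewrite ler_pM2l// (hMA, hMG)//;
    [exact: lt_le_trans uu|exact: lt_le_trans vv].
have supV : has_sup V.
  split; first by exists v1, u1.
  exists (K2 * MA) => v [u [uu vv _ h]].
  by apply: le_trans h (T2b _ _ _ _);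
    [exact: lt_le_trans uu|exact: lt_le_trans vv].
pose u := sup U; pose v := sup V.
have leu x y : P x y -> x <= u.
  by move=> p; apply: sup_upper_bound => //; exists y.
have lev x y : P x y -> y <= v.
  by move=> p; apply: sup_upper_bound => //; exists x.
have u0 : 0 < u := lt_le_trans u10 (leu _ _ P1).
have v0 : 0 < v := lt_le_trans v10 (lev _ _ P1).
have uT : u <= T1 u v.
  apply: ge_sup; first by case: supU.
  move=> x [y p]; have [hx hy h _] := p; apply: le_trans h _.
  by apply: T1m (leu _ _ p) (lev _ _ p);
    [exact: lt_le_trans hx|exact: lt_le_trans hy].
have vT : v <= T2 u v.
  apply: ge_sup; first by case: supV.
  move=> y [x p]; have [hx hy _ h] := p; apply: le_trans h _.
  by apply: T2m (leu _ _ p) (lev _ _ p);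
    [exact: lt_le_trans hx|exact: lt_le_trans hy].
(* The image of a subsolution is a subsolution, hence it lies below the suprema; this gives the
   reverse inequalities. *)
have PT : P (T1 u v) (T2 u v).
  by split; [exact: le_trans (leu _ _ P1) uT|exact: le_trans (lev _ _ P1) vT|
    exact: T1m|exact: T2m].
have eu : u = T1 u v by apply/le_anti; rewrite uT (leu _ _ PT).
have ev : v = T2 u v by apply/le_anti; rewrite vT (lev _ _ PT).
exists u, v; split=> //; split.
  by rewrite {1}eu /T1; ring.
have p := lt0r_neq0 (pos _ v0).
have -> : v + K2 * v * de2 v = v * (1 + K2 * de2 v) by ring.
by rewrite {1}ev /T2 mulfVK// mulrA.
Qed.

End existence.

(** * Monotonicity and strict concavity of tanh *)

Section tanh.
Context (R : realType).
Implicit Types x y : R.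

Lemma tanhE x : tanh x = 1 - 2 * (expR x ^+ 2 + 1)^-1.
Proof.
have e0 := expR_gt0 x; have p : 0 < expR x ^+ 2 + 1 by nra.
rewrite /tanh expRN; field.
by rewrite !lt0r_neq0//= mulr1 -expr2 addrC.
Qed.

Lemma ltr_tanh x y : x < y -> tanh x < tanh y.
Proof.
move=> xy; rewrite !tanhE ltrD2l ltrN2 ltr_pM2l// ltf_pV2 ?posrE ?addr_gt0//.
- by rewrite ltrD2r ltrXn2r// ?ltr_expR// ltW// expR_gt0.
- by rewrite exprn_gt0// expR_gt0.
- by rewrite exprn_gt0// expR_gt0.
Qed.

Lemma tanh0 : tanh 0 = 0 :> R.
Proof. by rewrite /tanh oppr0 subrr mul0r. Qed.

Lemma tanh_gt0 x : 0 < x -> 0 < tanh x.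
Proof. by move=> x0; rewrite -tanh0 ltr_tanh. Qed.

Lemma tanh_lt1 x : tanh x < 1.
Proof.
rewrite tanhE ltrBlDr ltrDl mulr_gt0// invr_gt0 addr_gt0// exprn_gt0//.
Qed.

Lemma is_derive_tanh x : is_derive x 1 (@tanh R) (1 - tanh x ^+ 2).
Proof.
have -> : @tanh R = fun z => 1 - 2 * (expR z ^+ 2 + 1)^-1.
  by apply/funext => z; rewrite tanhE.
have p : expR x ^+ 2 + 1 != 0.
  by rewrite lt0r_neq0// addr_gt0// exprn_gt0// expR_gt0.
have h : is_derive x 1 (fun z => expR z ^+ 2 + 1) (2 * expR x * expR x).
  apply: is_derive_eq.
  by rewrite addr0 /GRing.scale /=; ring.
have h2 := @is_deriveV _ (fun z => expR z ^+ 2 + 1) x _ 1 p h.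
apply: is_derive_eq.
rewrite /GRing.scale /=; field.
exact: p.
Qed.

(* [tanh] is strictly concave on the nonnegative reals and vanishes at 0. *)
Lemma tanh_slope_lt x y : 0 < x -> x < y -> x * tanh y < y * tanh x.
Proof.
move=> x0 xy.
have ct (a b : R) : {within `[a, b], continuous (@tanh R)}.
  apply: derivable_within_continuous => z _.
  exact: (@ex_derive _ _ _ _ _ _ _ (is_derive_tanh z)).
(* The mean value theorem on [0, x] and on [x, y] gives c1 < c2, and the derivative 1 - tanh^2 is
   strictly smaller at c2. *)
have [c1 /[!in_itv]/= /andP[c10 c1x]] :=
  MVT x0 (fun z _ => is_derive_tanh z) (ct _ _).
rewrite tanh0 !subr0 => e1.
have [c2 /[!in_itv]/= /andP[c2x _] e2] :=
  MVT xy (fun z _ => is_derive_tanh z) (ct _ _).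
have h : tanh c1 < tanh c2 by apply: ltr_tanh; lra.
have h1 := tanh_gt0 c10.
have : 1 - tanh c2 ^+ 2 < 1 - tanh c1 ^+ 2.
  by rewrite ltrD2l ltrN2 ltrXn2r// ltW.
move: e1 e2; set p := 1 - tanh c1 ^+ 2; set q := 1 - tanh c2 ^+ 2 => e1 e2 qp.
have -> : tanh y = p * x + q * (y - x) by rewrite -e1 -e2; ring.
have : q * (y - x) < p * (y - x) by rewrite ltr_pM2r ?subr_gt0.
rewrite e1 => hh; have : x * (q * (y - x)) < x * (p * (y - x)).
  by rewrite ltr_pM2l.
lra.
Qed.

End tanh.

(** * Monotonicity of f_beta and of f_beta(sqrt(w^2 + x^2)) *)

Section fbeta.
Context (R : realType) (beta : \bar R) (hbeta : (0 < beta)%E).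
Implicit Types s t w x : R.

Lemma fbeta_gt0 t : 0 < t -> 0 < fbeta beta t.
Proof.
case: beta hbeta => [b| |]//; rewrite ?lte_fin => b0 t0 /=.
  by rewrite gt_eqF// divr_gt0// tanh_gt0// divr_gt0// mulr_gt0.
by rewrite invr_gt0.
Qed.

(** For finite [beta] this is the strict decrease of the slope of the chord of tanh from the origin,
    at the points b s / 2 and b t / 2. *)
Lemma fbeta_lt s t : 0 < s -> s < t -> fbeta beta t < fbeta beta s.
Proof.
move=> s0 st; have t0 : 0 < t := lt_trans s0 st.
case: beta hbeta => [b| |]//; rewrite ?lte_fin => b0 /=.
  rewrite !gt_eqF// ltr_pdivrMr// [ltRHS]mulrAC ltr_pdivlMr// [ltLHS]mulrC.
  have bs0 : 0 < b * s / 2 by rewrite divr_gt0// mulr_gt0.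
  have bst : b * s / 2 < b * t / 2 by rewrite ltr_pM2r// ltr_pM2l.
  have := tanh_slope_lt bs0 bst.
  have h : 0 < b / 2 by rewrite divr_gt0.
  rewrite -[_ < tanh _ * _](ltr_pM2l h); lra.
by rewrite ltf_pV2 ?posrE.
Qed.

Lemma fbeta_le s t : 0 < s -> s <= t -> fbeta beta t <= fbeta beta s.
Proof.
by move=> s0; rewrite le_eqVlt => /predU1P[->//|st]; rewrite ltW// fbeta_lt.
Qed.

(** The product t f_beta(t) is tanh(beta t / 2) for finite [beta], and 1 for [beta = +oo]. *)
Lemma mul_fbeta_le s t : 0 < s -> s <= t ->
  s * fbeta beta s <= t * fbeta beta t.
Proof.
move=> s0 st; have t0 : 0 < t := lt_le_trans s0 st.
case: beta hbeta => [b| |]//; rewrite ?lte_fin => b0 /=.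
  rewrite !gt_eqF// ![_ * (_ / _)]mulrC !divfK ?gt_eqF//.
  move: st; rewrite le_eqVlt => /predU1P[->//|st].
  by rewrite ltW// ltr_tanh// ltr_pM2r// ltr_pM2l.
by rewrite !divff ?gt_eqF.
Qed.

Lemma mul_fbeta_le1 t : 0 < t -> t * fbeta beta t <= 1.
Proof.
move=> t0; case: beta hbeta => [b| |]//; rewrite ?lte_fin => b0 /=.
  by rewrite gt_eqF// mulrC divfK ?gt_eqF// ltW// tanh_lt1.
by rewrite divff ?gt_eqF.
Qed.

Definition fhypot w x := fbeta beta (Num.sqrt (w ^+ 2 + x ^+ 2)).

Lemma hypot_gt0 w x : 0 < w -> 0 < Num.sqrt (w ^+ 2 + x ^+ 2).
Proof. by move=> w0; rewrite sqrtr_gt0 ltr_pwDl ?sqr_ge0// exprn_gt0. Qed.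

Lemma fhypot_gt0 w x : 0 < w -> 0 < fhypot w x.
Proof. by move=> w0; rewrite fbeta_gt0// hypot_gt0. Qed.

Lemma fhypot_ltl s t x : 0 < s -> s < t -> fhypot t x < fhypot s x.
Proof.
move=> s0 st; apply: fbeta_lt; first exact: hypot_gt0.
rewrite ltr_sqrt; last by rewrite ltr_pwDl ?sqr_ge0// exprn_gt0// (lt_trans s0).
by rewrite ltrD2r ltrXn2r// ltW.
Qed.

Lemma fhypot_ler w x y : 0 < w -> 0 <= x -> x <= y -> fhypot w y <= fhypot w x.
Proof.
move=> w0 x0 xy; apply: fbeta_le; first exact: hypot_gt0.
by rewrite ler_wsqrtr// lerD2l lerXn2r// ?nnegrE// (le_trans x0).
Qed.

(** Both factors w / r and r f_beta(r) are nonnegative, nondecreasing in w and at most 1, so the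
    product inherits these properties. *)
Lemma mul_fhypotE w x : 0 < w -> let r := Num.sqrt (w ^+ 2 + x ^+ 2) in
  w * fhypot w x = w / r * (r * fbeta beta r).
Proof.
by move=> w0 r; rewrite mulrA divfK// lt0r_neq0// /r hypot_gt0.
Qed.

Lemma mul_fhypot_le s t x : 0 < s -> s <= t -> s * fhypot s x <= t * fhypot t x.
Proof.
move=> s0 st; have t0 : 0 < t := lt_le_trans s0 st.
have [rs rt] := (hypot_gt0 x s0, hypot_gt0 x t0).
have s2t2 : s ^+ 2 <= t ^+ 2 by rewrite lerXn2r// nnegrE ltW.
rewrite !mul_fhypotE//; apply: ler_pM.
- by rewrite divr_ge0// ltW.
- by rewrite mulr_ge0 ?ltW// fbeta_gt0.
- rewrite ler_pdivrMr// [leRHS]mulrAC ler_pdivlMr//.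
  (* Writing s and t as square roots of their squares reduces the claim to s^2 (t^2 + x^2) <= t^2
     (s^2 + x^2). *)
  rewrite -[X in X * _](ger0_norm (ltW s0)).
  rewrite -[X in _ <= X * _](ger0_norm (ltW t0)).
  rewrite -!sqrtr_sqr -!sqrtrM ?sqr_ge0// ler_wsqrtr// !mulrDr mulrC lerD2l.
  by rewrite ler_wpM2r// sqr_ge0.
- by rewrite mul_fbeta_le// ler_wsqrtr// lerD2r.
Qed.

Lemma mul_fhypot_le1 w x : 0 < w -> w * fhypot w x <= 1.
Proof.
move=> w0; have r0 := hypot_gt0 x w0.
rewrite mul_fhypotE// -[leRHS]mulr1; apply: ler_pM.
- by rewrite divr_ge0// ltW.
- by rewrite mulr_ge0 ?ltW// fbeta_gt0.
- rewrite ler_pdivrMr// mul1r -[leLHS](ger0_norm (ltW w0)) -sqrtr_sqr.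
  by rewrite ler_wsqrtr// lerDl sqr_ge0.
- exact: mul_fbeta_le1.
Qed.

End fbeta.

(** * Integrals bounded by step functions *)

Section step_functions.
Context d (T : measurableType d) (R : realType).
Context (mu : {measure set T -> \bar R}).
Context (J : set T) (N : nat) (E : 'I_N -> set T).
Hypotheses (mJ : measurable J) (mE : forall k, measurable (E k)).
Hypotheses (EJ : forall k, E k `<=` J) (finJ : (mu J < +oo)%E).

Let indicE_integrable (c : R) k :
  mu.-integrable J (EFin \o (fun x => c * \1_(E k) x)).
Proof.
have -> : EFin \o (fun x => c * \1_(E k) x) =
    (fun x => c%:E * (\1_(E k) x)%:E)%E.
  by apply/funext => x /=; rewrite EFinM.
apply: integrableZl => //; apply: measurable_bounded_integrable => //.
exists 1; split; rewrite ?num_real// => M M1 x _ /=.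
by rewrite (le_trans _ (ltW M1))// indicE ger0_norm ?ler0n// lern1 leq_b1.
Qed.

Lemma integrable_step (c : 'I_N -> R) :
  mu.-integrable J (EFin \o (fun x => \sum_(k < N) c k * \1_(E k) x)).
Proof.
have -> : EFin \o (fun x => \sum_(k < N) c k * \1_(E k) x) =
    (fun x => (\sum_(k < N) (c k * \1_(E k) x)%R%:E)%E).
  by apply/funext => x /=; rewrite sumEFin.
by apply: integrable_sum => // k _; exact: indicE_integrable.
Qed.

Lemma Rintegral_step (c : 'I_N -> R) :
  \int[mu]_(x in J) (\sum_(k < N) c k * \1_(E k) x) =
  \sum_(k < N) c k * fine (mu (E k)).
Proof.
have finE k : mu (E k) \is a fin_num.
  rewrite ge0_fin_numE// (le_lt_trans _ finJ)// le_measure ?inE//.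
rewrite /Rintegral.
have -> : (\int[mu]_(x in J) (\sum_(k < N) c k * \1_(E k) x)%:E)%E =
    (\int[mu]_(x in J) (\sum_(k < N) (c k * \1_(E k) x)%R%:E))%E.
  by apply: eq_integral => x _; rewrite /= sumEFin.
rewrite integral_sum//; last by move=> k; exact: indicE_integrable.
transitivity (fine (\sum_(k < N) (c k * fine (mu (E k)))%:E)); last first.
  by rewrite sumEFin.
congr fine; apply: eq_bigr => k _.
have -> : (\int[mu]_(x in J) (c k * \1_(E k) x)%R%:E)%E =
    (\int[mu]_(x in J) ((c k)%:E * (\1_(E k) x)%:E))%E by [].
rewrite integralZl//; last first.
  have := indicE_integrable 1 k.
  by apply: eq_integrable => // x _; rewrite /= mul1r.
by rewrite integral_indic// setIidl// EFinM fineK.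
Qed.

(** By disjointness at most one indicator is nonzero at each point; where all vanish, [f] is
    nonnegative. *)
Lemma sum_le_Rintegral (f : T -> R) (c : 'I_N -> R) :
  mu.-integrable J (EFin \o f) -> (forall x, J x -> 0 <= f x) ->
  trivIset setT E -> (forall k x, E k x -> c k <= f x) ->
  \sum_(k < N) c k * fine (mu (E k)) <= \int[mu]_(x in J) f x.
Proof.
move=> intf f0 dE cf; rewrite -Rintegral_step.
apply: le_Rintegral => //; first exact: integrable_step.
move=> x Jx; have [[k Ekx]|nE] := pselect (exists k, E k x); last first.
  rewrite big1 ?f0// => k _; rewrite indicE memNset ?mulr0// => Ekx.
  by apply: nE; exists k.
rewrite (bigD1 k)//= indicE mem_set// mulr1 big1 ?addr0 ?cf// => j jk.
rewrite indicE memNset ?mulr0// => Ejx.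
by move/eqP: jk; apply; apply: dE => //; exists x.
Qed.

(** One piece containing x already gives the bound, and the others add nonnegative terms. The pieces
    may overlap, so closed intervals sharing endpoints are allowed. *)
Lemma Rintegral_le_sum (f : T -> R) (c : 'I_N -> R) :
  mu.-integrable J (EFin \o f) -> (forall k, 0 <= c k) ->
  J `<=` \bigcup_k E k -> (forall k x, E k x -> f x <= c k) ->
  \int[mu]_(x in J) f x <= \sum_(k < N) c k * fine (mu (E k)).
Proof.
move=> intf c0 JE fc; rewrite -Rintegral_step.
apply: le_Rintegral => //; first exact: integrable_step.
move=> x Jx; have [k _ Ekx] := JE x Jx.
rewrite (bigD1 k)//= indicE mem_set// mulr1 ler_wpDr ?fc// sumr_ge0// => j _.
by rewrite mulr_ge0.
Qed.

End step_functions.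

(** * Partitions, their endpoints and lengths *)

Section partition.
Context (R : realType).

Lemma closure_itvoo (x y : R) : x < y -> closure `]x, y[ = `[x, y]%classic.
Proof.
move=> xy; apply/seteqP; split; first exact: itv_closure.
move=> z /=; rewrite in_itv/= => /andP[xz zy] B /nbhs_ballP[e /= e0 zeB].
have [ltzy|leyz] := ltP z y.
  (* The midpoint of z and m lies in the open interval and within e of z; when z = y the same is
     done to the left. *)
  pose m := Num.min (z + e) y.
  have zm : z < m by rewrite lt_min ltzy ltrDl e0.
  have m1 : m <= z + e by rewrite ge_min lexx.
  have m2 : m <= y by rewrite ge_min lexx orbT.
  exists ((z + m) / 2); split; first by rewrite /= in_itv/=; lra.
  by apply: zeB; rewrite /ball/= ltr_distlC; lra.
pose m := Num.max (z - e) x.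
have mz : m < z by rewrite gt_max ltrBlDr ltrDl e0; lra.
have m1 : z - e <= m by rewrite le_max lexx.
have m2 : x <= m by rewrite le_max lexx orbT.
exists ((z + m) / 2); split; first by rewrite /= in_itv/=; lra.
by apply: zeB; rewrite /ball/= ltr_distlC; lra.
Qed.

Lemma partition_endpoints (c d : R) N (I : 'I_N -> set R) :
  is_partition `[c, d] I ->
  exists x y : 'I_N -> R, forall k,
    [/\ c <= x k, x k < y k, I k = `]x k, y k[%classic
      & closure (I k) = `[x k, y k]%classic].
Proof.
move=> [itv sub _ _].
have /choice[x hx] : forall k,
    exists x, exists y, x < y /\ I k = `]x, y[%classic by [].
have /choice[y hy] := hx.
exists x, y => k; have [xy Ik] := hy k.
have clI : closure (I k) = `[x k, y k]%classic by rewrite Ik closure_itvoo.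
(* Since [[c, d]] is closed it contains the closure of the piece, hence the endpoint [x k]. *)
split=> //; have : closure (I k) `<=` `[c, d].
  have -> : `[c, d]%classic = closure (`[c, d] : set R).
    by rewrite -(closure_id _).1//; exact: itv_closed.
  exact/closureS/sub.
rewrite clI => /(_ (x k)); rewrite /= !in_itv/= lexx ltW// => /(_ isT).
by case/andP.
Qed.

Lemma set_minE (A : set R) m : A m -> lbound A m -> set_min A = m.
Proof.
move=> Am lbm; apply: xget_unique => // z [Az lbz].
by apply/le_anti; rewrite lbz// lbm.
Qed.

Lemma set_maxE (A : set R) m : A m -> ubound A m -> set_max A = m.
Proof.
move=> Am ubm; apply: xget_unique => // z [Az ubz].
by apply/le_anti; rewrite ubm// ubz.
Qed.

Lemma set_length_itv (x y : R) b1 b2 : x < y ->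
  set_length [set` Interval (BSide b1 x) (BSide b2 y)] = y - x.
Proof. by move=> xy; rewrite /set_length lebesgue_measure_itv/= lte_fin xy. Qed.

End partition.

Lemma regular_ext (R : realType) (f g : R -> R) :
  (forall t, 0 < t -> f t = g t) -> regular g -> regular f.
Proof.
move=> fg [g0 ga gm [M gM]].
have pos (s t : R) : 0 < s -> s <= t -> 0 < t by exact: lt_le_trans.
split=> [t t0|s t s0 st|s t s0 st|].
- by rewrite fg ?g0.
- by rewrite (fg s)// (fg t (pos _ _ s0 st)) ga.
- by rewrite (fg s)// (fg t (pos _ _ s0 st)) gm.
- by exists M => t t0; rewrite (fg t t0) (gM t t0).
Qed.

(** * The lower and upper sums and the integral between them *)

Section quadrature.
Context (R : realType) (beta : \bar R) (hbeta : (0 < beta)%E).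

Let k := fhypot beta.

Lemma regular_fhypot_sum N (p l : 'I_N -> R) : (forall i, 0 <= l i) ->
  regular (fun w => \sum_(i < N) k w (p i) * l i).
Proof.
move=> l0; have k0 w x : 0 < w -> 0 <= k w x.
  by move=> w0; rewrite ltW// fhypot_gt0.
split=> [t t0|s t s0 st|s t s0 st|].
- by apply: sumr_ge0 => i _; rewrite mulr_ge0// k0.
- apply: ler_sum => i _; rewrite ler_wpM2r//.
  by move: st; rewrite le_eqVlt => /predU1P[->//|st]; rewrite ltW// fhypot_ltl.
- rewrite !mulr_sumr; apply: ler_sum => i _.
  by rewrite !mulrA ler_wpM2r// mul_fhypot_le.
- exists (\sum_(i < N) l i) => t t0; rewrite mulr_sumr; apply: ler_sum => i _.
  by rewrite mulrA ler_piMl// mul_fhypot_le1.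
Qed.

Lemma fhypot_sum_lt N (p l : 'I_N -> R) s t :
  (0 < N)%N -> (forall i, 0 < l i) -> 0 < s -> s < t ->
  \sum_(i < N) k t (p i) * l i < \sum_(i < N) k s (p i) * l i.
Proof.
move=> N0 l0 s0 st; apply: ltr_sum => [|i _].
  by apply/hasP; exists (Ordinal N0); rewrite ?mem_index_enum.
by rewrite ltr_pM2r// fhypot_ltl.
Qed.

Lemma set_min_fhypot w x y : 0 < w -> 0 <= x -> x < y ->
  set_min [set k w z | z in `[x, y]%classic] = k w y.
Proof.
move=> w0 x0 xy; apply: set_minE.
  by exists y => //=; rewrite in_itv/= lexx ltW.
move=> _ [z /= + <-]; rewrite in_itv/= => /andP[xz zy].
by apply: fhypot_ler => //; exact: le_trans xz.
Qed.

Lemma set_max_fhypot w x y : 0 < w -> 0 <= x -> x < y ->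
  set_max [set k w z | z in `[x, y]%classic] = k w x.
Proof.
move=> w0 x0 xy; apply: set_maxE.
  by exists x => //=; rewrite in_itv/= lexx ltW.
move=> _ [z /= + <-]; rewrite in_itv/= => /andP[xz zy].
exact: fhypot_ler.
Qed.

Section interval.
Context (c d : R) (hc : 0 <= c) (hcd : c < d).

Let J : set R := `[c, d]%classic.

Let mJ : measurable J. Proof. exact: measurable_itv. Qed.

Let finJ : (lebesgue_measure J < +oo)%E.
Proof. by rewrite /J lebesgue_measure_itv/= lte_fin hcd -EFinB ltry. Qed.

Lemma fhypot_integrable w : 0 < w ->
  lebesgue_measure.-integrable J (EFin \o k w).
Proof.
move=> w0; apply: measurable_bounded_integrable => //.
(* Truncation at 0 makes the function nonincreasing on the whole line, hence measurable, without
   changing it on [J]. *)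
- have mf : measurable_fun J (fun x => k w (Num.max x 0)).
    apply: nonincreasing_measurable => // x y xy.
    apply: fhypot_ler => //; first by rewrite le_max lexx orbT.
    by rewrite ge_max !le_max xy lexx orbT.
  apply: eq_measurable_fun mf => x.
  rewrite inE /J/= in_itv/= => /andP[cx _].
  by rewrite max_l// (le_trans hc).
- exists (k w 0); split; rewrite ?num_real// => M kM x.
  rewrite /J/= in_itv/= => /andP[cx _].
  rewrite ger0_norm ?ltW ?fhypot_gt0// (le_lt_trans _ kM)//.
  by rewrite fhypot_ler// (le_trans hc).
Qed.

Lemma regular_fhypot_Rintegral :
  regular (fun w => \int[lebesgue_measure]_(x in J) k w x).
Proof.
have cJ (r : R) : lebesgue_measure.-integrable J (EFin \o cst r).
  by apply: measurable_bounded_integrable; [|exact: finJ| |exact: bounded_cst].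
have wk w r : 0 < w ->
    lebesgue_measure.-integrable J (EFin \o (fun x => r * k w x)).
  move=> w0.
  have -> : EFin \o (fun x => r * k w x) = (fun x => r%:E * (k w x)%:E)%E.
    by apply/funext => x /=; rewrite EFinM.
  by apply: integrableZl => //; exact: fhypot_integrable.
split=> [t t0|s t s0 st|s t s0 st|].
- by apply: Rintegral_ge0 => x _; rewrite ltW// fhypot_gt0.
- have t0 := lt_le_trans s0 st.
  apply: le_Rintegral => //; [exact: fhypot_integrable..|] => x _.
  by move: st; rewrite le_eqVlt => /predU1P[->//|st]; rewrite ltW// fhypot_ltl.
- have t0 := lt_le_trans s0 st.
  rewrite -!RintegralZl//; [|exact: fhypot_integrable..].
  by apply: le_Rintegral => //; [exact: wk..|] => x _; exact: mul_fhypot_le.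
- exists (\int[lebesgue_measure]_(x in J) cst 1 x) => t t0.
  rewrite -RintegralZl//; last exact: fhypot_integrable.
  by apply: le_Rintegral => //; [exact: wk|] => x _; exact: mul_fhypot_le1.
Qed.

Context (N : nat) (I : 'I_N -> set R) (hI : is_partition J I).

(** The sums can be strictly decreasing only if they are nonempty; a piece is found by covering the
    point [c]. *)
Lemma partition_size_gt0 : (0 < N)%N.
Proof.
have [_ _ _ cov] := hI; have [|i _ _] := cov c.
  by rewrite /J/= in_itv/= lexx ltW.
exact: leq_trans (ltn_ord i).
Qed.

(** As the summand is nonincreasing in x, minima sit at right endpoints and maxima at left ones. For
    w > 0 both sums thus become weighted point evaluations with nodes and weights independent of
    w. *)
Lemma min_max_sumE : exists p q l : 'I_N -> R,
  [/\ forall i, 0 < l i,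
      forall w, 0 < w -> min_sum I beta w = \sum_(i < N) k w (q i) * l i
    & forall w, 0 < w -> max_sum I beta w = \sum_(i < N) k w (p i) * l i].
Proof.
have [x [y xy]] := partition_endpoints hI.
exists x, y, (fun i => y i - x i); split.
- by move=> i; have [_ ? _ _] := xy i; rewrite subr_gt0.
- move=> w w0; apply: eq_bigr => i _; have [cx ltxy _ ->] := xy i.
  rewrite set_length_itv//; congr (_ * _); apply: set_min_fhypot => //.
  exact: le_trans hc cx.
- move=> w w0; apply: eq_bigr => i _; have [cx ltxy _ ->] := xy i.
  rewrite set_length_itv//; congr (_ * _); apply: set_max_fhypot => //.
  exact: le_trans hc cx.
Qed.

Lemma regular_min_sum : regular (min_sum I beta).
Proof.
have [_ [q [l [l0 minE _]]]] := min_max_sumE.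
by apply: regular_ext minE _; apply: regular_fhypot_sum => i; rewrite ltW.
Qed.

Lemma regular_max_sum : regular (max_sum I beta).
Proof.
have [p [_ [l [l0 _ maxE]]]] := min_max_sumE.
by apply: regular_ext maxE _; apply: regular_fhypot_sum => i; rewrite ltW.
Qed.

Lemma min_sum_lt s t : 0 < s -> s < t -> min_sum I beta t < min_sum I beta s.
Proof.
move=> s0 st; have [_ [q [l [l0 minE _]]]] := min_max_sumE.
rewrite !minE ?(lt_trans s0 st)//.
by apply: fhypot_sum_lt => //; exact: partition_size_gt0.
Qed.

Lemma max_sum_lt s t : 0 < s -> s < t -> max_sum I beta t < max_sum I beta s.
Proof.
move=> s0 st; have [p [_ [l [l0 _ maxE]]]] := min_max_sumE.
rewrite !maxE ?(lt_trans s0 st)//.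
by apply: fhypot_sum_lt => //; exact: partition_size_gt0.
Qed.

Lemma min_sum_le_Rintegral :
  le_on_pos (min_sum I beta) (fun w => \int[lebesgue_measure]_(x in J) k w x).
Proof.
move=> w w0; have [x [y xy]] := partition_endpoints hI.
have [_ IJ dI _] := hI.
(* The open pieces have the same lengths as their closures and are disjoint, as the lower bound
   requires. *)
have -> : min_sum I beta w =
    \sum_(i < N) k w (y i) * fine (lebesgue_measure (I i)).
  apply: eq_bigr => i _; have [cx ltxy -> ->] := xy i.
  rewrite -/(set_length _) !set_length_itv//; congr (_ * _).
  apply: set_min_fhypot => //.
  exact: le_trans hc cx.
apply: sum_le_Rintegral => //.
- by move=> i; have [_ _ -> _] := xy i; exact: measurable_itv.
- exact: fhypot_integrable.
- by move=> z _; rewrite ltW// fhypot_gt0.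
- move=> i z; have [cx _ -> _] := xy i; rewrite /= in_itv/=.
  move=> /andP[/ltW xz /ltW zy].
  by apply: fhypot_ler => //; exact: le_trans hc (le_trans cx xz).
Qed.

Lemma Rintegral_le_max_sum :
  le_on_pos (fun w => \int[lebesgue_measure]_(x in J) k w x) (max_sum I beta).
Proof.
move=> w w0; have [x [y xy]] := partition_endpoints hI.
have [_ IJ _ cov] := hI.
(* Here the closures are kept, because they are what covers [J]. *)
have -> : max_sum I beta w =
    \sum_(i < N) k w (x i) * fine (lebesgue_measure (closure (I i))).
  apply: eq_bigr => i _; have [cx ltxy _ ->] := xy i.
  congr (_ * _); apply: set_max_fhypot => //.
  exact: le_trans hc cx.
apply: Rintegral_le_sum => //.
- by move=> i; have [_ _ _ ->] := xy i; exact: measurable_itv.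
- move=> i; have -> : J = closure J.
    by rewrite -(closure_id _).1//; exact: itv_closed.
  exact/closureS/IJ.
- exact: fhypot_integrable.
- by move=> i; rewrite ltW// fhypot_gt0.
- move=> i z; have [cx _ _ ->] := xy i; rewrite /= in_itv/= => /andP[xz zy].
  by apply: fhypot_ler => //; exact: le_trans hc cx.
Qed.

End interval.
End quadrature.

(** * From domination to critical numbers and solutions *)

(** The first clause orders two positive solutions. The second compares critical numbers and
    excludes a trivial solution of [S2] facing a positive one of [S1]. *)
Definition dominated (R : realType) (beta : \bar R)
    (S1 S2 : \bar R -> R -> R -> Prop) : Prop :=
  (forall u1 v1 u2 v2 : R, 0 < u1 -> 0 < v1 -> 0 < u2 -> 0 < v2 ->
     S1 beta u1 v1 -> S2 beta u2 v2 -> u1 <= u2 /\ v1 <= v2) /\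
  (forall u1 v1 : R, 0 < u1 -> 0 < v1 -> S1 beta u1 v1 ->
     exists u v, [/\ 0 < u, 0 < v & S2 beta u v]).

Lemma dominated_critical_number (R : realType)
    (S1 S2 : \bar R -> R -> R -> Prop) (b1 b2 : R) :
  (forall beta, (0 < beta)%E -> dominated beta S1 S2) ->
  critical_number S1 b1 -> critical_number S2 b2 -> b2 <= b1.
Proof.
move=> dom [b10 sol1 _] [b20 _ triv2]; rewrite leNgt; apply/negP => b12.
(* Strictly between [b1] and [b2], the system [S1] has a positive solution, which passes to [S2],
   although [S2] is still in its trivial range. *)
pose m := (b1 + b2) / 2.
have m0 : (0 < m%:E)%E by rewrite lte_fin /m; lra.
have [|u1 [v1 [u10 v10 S1uv]]] := sol1 m%:E; first by rewrite lte_fin /m; lra.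
have [u [v [u0 _ S2uv]]] := (dom _ m0).2 u1 v1 u10 v10 S1uv.
have mb2 : (m%:E < b2%:E)%E by rewrite lte_fin /m; lra.
have [ue _] := (triv2 _ m0 mb2 u v).1 S2uv.
by rewrite ue ltxx in u0.
Qed.

Lemma dominated_solution (R : realType) (S1 S2 : \bar R -> R -> R -> Prop)
    (beta : \bar R) (u1 v1 u2 v2 : R) : dominated beta S1 S2 ->
  solution S1 beta u1 v1 -> solution S2 beta u2 v2 ->
  pair_le (u1, v1) (u2, v2).
Proof.
move=> [le ex] [S1uv [[u10 v10]|[-> [-> _]]]]
  [S2uv [[u20 v20]|[u2e [v2e triv]]]].
- exact: le.
- have [u [v [u0 _ /triv[ue _]]]] := ex _ _ u10 v10 S1uv.
  by rewrite ue ltxx in u0.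
- by split; exact: ltW.
- by rewrite u2e v2e.
Qed.

Lemma continuous_systemE (R : realType) (a b K1 K2 : R) (beta : \bar R)
    (u v : R) :
  let G c d w := \int[lebesgue_measure]_(x in `[c, d]) fhypot beta w x in
  continuous_system a b K1 K2 beta u v <->
  mixed_system K1 K2 (G 0 a) (G a b) (G a b) u v.
Proof.
move=> G; rewrite /continuous_system /A_beta /B_beta -/(G 0 a u) -/(G a b v).
by split=> -[e1 e2]; split; lra.
Qed.

Theorem theorem2p4 (R : realType) (a b K1 K2 : R) (N : nat)
    (I I' : 'I_N -> set R)
    (ha : 0 < a) (hab : a < b) (hK2 : 0 < K2) (hK : K2 < K1)
    (hI : is_partition `[0, a] I) (hI' : is_partition `[a, b] I') :
  (forall bc bc' bc'' : R,
     critical_number (continuous_system a b K1 K2) bc ->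
     critical_number (min_mixed_system K1 K2 I I') bc' ->
     critical_number (max_mixed_system K1 K2 I I') bc'' ->
     bc' >= bc /\ bc >= bc'') /\
  (forall (beta : \bar R) (um vm u v uM vM : R), (0 < beta)%E ->
     solution (min_mixed_system K1 K2 I I') beta um vm ->
     solution (continuous_system a b K1 K2) beta u v ->
     solution (max_mixed_system K1 K2 I I') beta uM vM ->
     pair_le (um, vm) (u, v) /\ pair_le (u, v) (uM, vM)).
Proof.
have a0 := ltW ha.
have dom_min beta : (0 < beta)%E -> dominated beta
    (min_mixed_system K1 K2 I I') (continuous_system a b K1 K2).
  move=> hb; have regA := regular_fhypot_Rintegral hb (lexx 0) ha.
  have regG := regular_fhypot_Rintegral hb a0 hab.
  split=> [u1 v1 u2 v2 u10 v10 u20 v20 S1 /continuous_systemE S2|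
      u1 v1 u10 v10 S1].
    (* The strictly decreasing intermediate function is the lower sum over [0, a], that is, [al1]
       itself; the comparisons left open are reflexive. *)
    apply: (mixed_system_le hK2 hK (regular_min_sum hb (lexx 0) hI) regG
      (min_sum_lt hb (lexx 0) ha hI) _ (min_sum_le_Rintegral hb (lexx 0) ha hI)
      (min_sum_le_Rintegral hb a0 hab hI') (Rintegral_le_max_sum hb a0 hab hI')
      _ _ (regular_ge0 (regular_min_sum hb (lexx 0) hI)) (regular_ge0 regG)
      u10 v10 u20 v20 S1 S2) => t _; exact: lexx.
  have [u [v [u0 v0 S2]]] := mixed_system_exists hK2 hK regA regG regG
    (min_sum_le_Rintegral hb (lexx 0) ha hI)
    (min_sum_le_Rintegral hb a0 hab hI') (Rintegral_le_max_sum hb a0 hab hI')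
    u10 v10 S1.
  by exists u, v; split=> //; apply/continuous_systemE.
have dom_max beta : (0 < beta)%E -> dominated beta
    (continuous_system a b K1 K2) (max_mixed_system K1 K2 I I').
  move=> hb; have regA := regular_fhypot_Rintegral hb (lexx 0) ha.
  have regG := regular_fhypot_Rintegral hb a0 hab.
  have regm := regular_min_sum hb a0 hI'.
  split=> [u1 v1 u2 v2 u10 v10 u20 v20 /continuous_systemE S1 S2|
      u1 v1 u10 v10 /continuous_systemE S1].
    (* This time the intermediate function is the upper sum, that is, [al2] itself. *)
    apply: (mixed_system_le hK2 hK (regular_max_sum hb (lexx 0) hI) regG
      (max_sum_lt hb (lexx 0) ha hI) (Rintegral_le_max_sum hb (lexx 0) ha hI) _
      _ _ (min_sum_le_Rintegral hb a0 hab hI')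
      (Rintegral_le_max_sum hb a0 hab hI') (regular_ge0 regA)
      (regular_ge0 regm) u10 v10 u20 v20 S1 S2) => t _; exact: lexx.
  exact: (mixed_system_exists hK2 hK (regular_max_sum hb (lexx 0) hI)
    (regular_max_sum hb a0 hI') regm
    (Rintegral_le_max_sum hb (lexx 0) ha hI)
    (Rintegral_le_max_sum hb a0 hab hI') (min_sum_le_Rintegral hb a0 hab hI')
    u10 v10 S1).
split=> [bc bc' bc'' hc hm hM|beta um vm u v uM vM hb hm hc hM].
  by split; [exact: dominated_critical_number dom_min hm hc|
    exact: dominated_critical_number dom_max hc hM].
by split; [exact: dominated_solution (dom_min _ hb) hm hc|
  exact: dominated_solution (dom_max _ hb) hc hM].
Qed.
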